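(* Let $(X,\mathcal B,\mu)$ be a standard probability space and let $f\in L^1(X,\mathcal B,\mu)$ be real-valued and not a constant function (i.e. not $\mu$-a.e. equal to a constant). Then there exists $d>0$ such that for all ergodic $T$ on $(X,\mathcal B,\mu)$, for $\mu$-a.e. $x$, $$\mathbb A_{[N+1]}f(T^nx)>\frac dN+\mathbb A_{[N]}f(T^nx)\quad\text{for infinitely many }N,$$ and $$\mathbb A_{[N+1]}f(T^nx)<-\frac dN+\mathbb A_{[N]}f(T^nx)\quad\text{for infinitely many }N.$$
   Context: For $N\ge 1$, $\mathbb A_{[N]}f(T^nx)=\frac1N\sum_{n=1}^{N}f(T^nx)$. ''Ergodic $T$'' means an ergodic, invertible, measure-preserving map of $(X,\mathcal B,\mu)$. The constant $d$ depends on $f$ but not on $T$. *)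

(* Defs.v *)
From mathcomp Require Import all_boot all_order all_algebra.
From mathcomp Require Import all_classical all_reals all_analysis.
From mathcomp Require Import measurable_realfun.

Set Implicit Arguments.
Unset Strict Implicit.
Unset Printing Implicit Defensive.
Import Order.TTheory GRing.Theory Num.Theory.

Local Open Scope classical_set_scope.
Local Open Scope ring_scope.

(* [mu] is isomorphic mod 0 to a Borel probability measure on the real line,
   namely its image under [phi].  The inverse of [phi] is only required to be
   measurable for the completion of the image measure, so that both standard
   Borel spaces with a probability measure and their completions
   (Lebesgue-Rokhlin spaces) are covered.  Atoms are allowed. *)
Definition standard_probability (R : realType) (d : measure_display)
    (X : measurableType d) (mu : probability X R) : Prop :=
  exists (X0 : set X) (phi : X -> R),
    [/\ measurable X0 /\ mu X0 = 1%E,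
        measurable_fun setT phi,
        {in X0 &, injective phi} &
        forall A : set X, measurable A -> A `<=` X0 ->
          completed_algebra_gen (pushforward mu phi) (phi @` A)].

Definition measure_preserving (R : realType) (d : measure_display)
    (X : measurableType d) (mu : probability X R) (T : X -> X) : Prop :=
  measurable_fun setT T /\
  forall A : set X, measurable A -> mu (T @^-1` A) = mu A.

(* Invertibility is understood mod 0: the measurable inverse inverts [T] almost
   everywhere; in particular every bijection with measurable inverse
   qualifies. *)
Definition invertible_mod0 (R : realType) (d : measure_display)
    (X : measurableType d) (mu : probability X R) (T : X -> X) : Prop :=
  exists S : X -> X,
    [/\ measurable_fun setT S,
        {ae mu, forall x, S (T x) = x} &
        {ae mu, forall x, T (S x) = x}].

Definition ergodic (R : realType) (d : measure_display)
    (X : measurableType d) (mu : probability X R) (T : X -> X) : Prop :=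
  [/\ measure_preserving mu T,
      invertible_mod0 mu T &
      forall A : set X, measurable A -> T @^-1` A = A ->
        mu A = 0%E \/ mu A = 1%E].

Definition ergodic_average (R : realType) (X : Type) (T : X -> X) (f : X -> R)
    (N : nat) (x : X) : R :=
  N%:R^-1 * \sum_(1 <= n < N.+1) f (iter n T x).

(* Main.v *)
(** Write m for the integral of f and A_N for the averages.  Since
    A_(N+1) - A_N = (f(T^(N+1) x) - A_N) / (N+1), an increment above d / N
    occurs as soon as f(T^(N+1) x) > m + 4d while A_N <= m + 2d.  The first
    condition holds infinitely often by recurrence, for d so small that
    {f > m + 4d} has positive measure.  The second holds eventually, and only
    this half of Birkhoff's theorem is needed: the Birkhoff sums of
    g = f - (m + d), whose integral is negative, are almost surely bounded
    above.  Decrements are increments for -f. *)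

Require Import Defs.
From mathcomp Require Import all_boot all_order all_algebra.
From mathcomp Require Import all_classical all_reals all_analysis.
From mathcomp Require Import measurable_realfun ring lra.

Set Implicit Arguments.
Unset Strict Implicit.
Unset Printing Implicit Defensive.
Import Order.TTheory GRing.Theory Num.Theory.

Local Open Scope classical_set_scope.
Local Open Scope ring_scope.

(** * Infinite sets, almost sure events and measure-preserving maps *)

Lemma frequently_infinite_set (A : set nat) :
  (forall m : nat, exists n, (m <= n)%N /\ A n) -> infinite_set A.
Proof.
move=> Af /finite_seqP[s As].
have [n [sn]] := Af (\max_(i <- s) i).+1.
rewrite As /= => /leq_bigmax_seq => /(_ (fun=> true) id isT).
by rewrite leqNgt sn.
Qed.

Lemma probability1_ae (R : realType) (disp : measure_display)
    (X : measurableType disp) (mu : probability X R) (A : set X) :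
  measurable A -> mu A = 1%E -> {ae mu, forall x, A x}.
Proof.
move=> mA muA; exists (~` A); split => //; first exact: measurableC.
by rewrite probability_setC// muA subee.
Qed.

Lemma measurable_superlevel (R : realType) (disp : measure_display)
    (X : measurableType disp) (f : X -> R) (c : R) :
  measurable_fun setT f -> measurable [set x | c < f x].
Proof.
move=> mf; have := mf measurableT `]c, +oo[%classic (measurable_itv _).
by rewrite setTI; congr (measurable _); apply/seteqP; split => x /=;
  rewrite in_itv/= andbT.
Qed.

Lemma measurable_iter (disp : measure_display) (X : measurableType disp)
    (T : X -> X) (n : nat) :
  measurable_fun setT T -> measurable_fun setT (iter n T).
Proof.
move=> mT; elim: n => [|n IH]; first exact: measurable_id.
exact: (measurableT_comp mT IH).
Qed.

(** Change of variables: the pushforward of [mu] under [T] agrees with [mu] on measurable sets. *)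
Lemma integrable_measure_preserving (R : realType) (disp : measure_display)
    (X : measurableType disp) (mu : probability X R) (T : X -> X)
    (h : X -> \bar R) :
  measure_preserving mu T -> mu.-integrable setT h ->
  mu.-integrable setT (h \o T).
Proof.
move=> [mT presT] /integrableP[mh ih]; apply/integrableP; split.
  exact: measurableT_comp mh mT.
have mah : measurable_fun setT (fun x => `|h x|%E) by exact: measurableT_comp.
have := ge0_integral_pushforward mT mu measurableT mah (fun x _ => abse_ge0 (h x)).
rewrite preimage_setT /= => <-.
rewrite (eq_measure_integral mu) // => A mA _.
exact: presT.
Qed.

Lemma integral_measure_preserving (R : realType) (disp : measure_display)
    (X : measurableType disp) (mu : probability X R) (T : X -> X)
    (h : X -> \bar R) :
  measure_preserving mu T -> mu.-integrable setT h ->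
  (\int[mu]_x h (T x) = \int[mu]_x h x)%E.
Proof.
move=> pT ih; have ihT := integrable_measure_preserving pT ih.
have [mT presT] := pT; have /integrableP[mh _] := ih.
have := integral_pushforward mT mh ihT measurableT.
rewrite preimage_setT /= => <-.
by apply: eq_measure_integral => A mA _; exact: presT.
Qed.

(** * Recurrence to sets of positive measure *)

(** The points visiting [E] infinitely often form the upper limit of the sets [F n], which is
    strictly invariant. Its measure is at least [mu E > 0], so ergodicity makes it 1. *)
Lemma ergodic_recurrence (R : realType) (disp : measure_display)
    (X : measurableType disp) (mu : probability X R) (T : X -> X) (E : set X) :
  ergodic mu T -> measurable E -> (0 < mu E)%E ->
  {ae mu, forall x, forall m, exists n, (m <= n)%N /\ E (iter n T x)}.
Proof.
move=> [[mT presT] _ ergT] mE muE.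
pose F n := iter n T @^-1` E.
have mF n : measurable (F n).
  by rewrite -[F n]setTI; exact: measurable_iter.
have muF n : mu (F n) = mu E.
  elim: n => [//|n <-]; rewrite -(presT (F n))//; congr (mu _).
  by apply/seteqP; split => x; rewrite /F /= -iterS iterSr.
have mB : measurable (lim_sup_set F).
  by apply: bigcap_measurable => // k _; exact: bigcup_measurable.
have inv : T @^-1` lim_sup_set F = lim_sup_set F.
  apply/seteqP; split => x /= Bx m _.
    have [k /= mk Fk] := Bx m I.
    by exists k.+1; [exact: leqW | rewrite /F /= -iterS iterSr].
  (* Starting from [m.+1] makes the visiting time a successor, which can be lowered by one and stay
     at least [m]. *)
  have [[//|k] /= mk Fk] := Bx m.+1 I.
  by exists k => //; rewrite /F /= -iterSr.
have muB : (mu E <= mu (lim_sup_set F))%E.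
  have fin : (mu (\bigcup_(k >= 0) F k) < +oo)%E.
    apply: (@le_lt_trans _ _ 1%E); last exact: ltry.
    by apply: probability_le1; exact: bigcup_measurable.
  (* Continuity from above: each tail union contains [F n], of measure [mu E]. *)
  apply: (cvge_ge _ (lim_sup_set_cvg mu F mF fin)); apply: nearW => n.
  rewrite -(muF n) le_measure ?inE//; first exact: bigcup_measurable.
  by move=> x Fx; exists n => /=.
case: (ergT _ mB inv) => B1; first by move: muB; rewrite B1 leNgt muE.
apply: filterS (probability1_ae mB B1) => x Bx m.
by have [k mk Fk] := Bx m I; exists k.
Qed.

(** * Maxima of Birkhoff sums and their boundedness *)

(* [max_birkhoff T g n x] is the maximum of the Birkhoff sums of [g] at [x] of
   lengths [0] to [n]. *)
Fixpoint max_birkhoff (R : realType) (X : Type) (T : X -> X) (g : X -> R)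
    (n : nat) (x : X) : R :=
  if n is n'.+1 then Num.max 0 (g x + max_birkhoff T g n' (T x)) else 0.

Lemma max_birkhoff_ge0 (R : realType) (X : Type) (T : X -> X) (g : X -> R) n x :
  0 <= max_birkhoff T g n x.
Proof. by case: n => [//|n] /=; rewrite le_max lexx. Qed.

Lemma max_birkhoff_leS (R : realType) (X : Type) (T : X -> X) (g : X -> R) n x :
  max_birkhoff T g n x <= max_birkhoff T g n.+1 x.
Proof.
elim: n x => [|n IH] x; first exact: max_birkhoff_ge0.
by rewrite [leLHS]/= [leRHS]/= le_max2// lerD2l.
Qed.

Lemma le_max_birkhoff (R : realType) (X : Type) (T : X -> X) (g : X -> R) x :
  {homo max_birkhoff T g ^~ x : m n / (m <= n)%N >-> m <= n}.
Proof.
apply: homo_leq => //; first by move=> y z w; exact: le_trans.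
by move=> n; exact: max_birkhoff_leS.
Qed.

Lemma birkhoff_sum_le_max (R : realType) (X : Type) (T : X -> X) (g : X -> R) n x :
  \sum_(0 <= k < n) g (iter k T x) <= max_birkhoff T g n x.
Proof.
elim: n x => [|n IH] x; first by rewrite big_geq.
rewrite big_nat_recl//= le_max lerD2l; apply/orP; right.
by under eq_bigr do rewrite -iterS iterSr; exact: IH.
Qed.

Lemma integrable_max_birkhoff (R : realType) (disp : measure_display)
    (X : measurableType disp) (mu : probability X R) (T : X -> X) (g : X -> R) n :
  measure_preserving mu T -> mu.-integrable setT (EFin \o g) ->
  mu.-integrable setT (EFin \o max_birkhoff T g n).
Proof.
move=> pT ig; elim: n => [|n IH]; first exact: integrable0.
have ih := integrableD measurableT ig (integrable_measure_preserving pT IH).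
apply: (le_integrable measurableT _ _ ih).
  have /integrableP[/measurable_EFinP mh _] := ih.
  by apply/measurable_EFinP; apply: measurable_maxr.
move=> x _ /=; rewrite lee_fin.
by case: (leP 0 (g x + max_birkhoff T g n (T x))) => h; rewrite ?normr0.
Qed.

(* The set [A] where the maxima [M n] are unbounded is invariant.  If it had full
   measure, then [M n.+1 - M n \o T = max (- M n \o T) g] would converge almost
   everywhere to [g], dominated by [|g|], while its integral, that of
   [M n.+1 - M n], is nonnegative; so [g] would have nonnegative integral. *)
Lemma birkhoff_sum_bounded_above (R : realType) (disp : measure_display)
    (X : measurableType disp) (mu : probability X R) (T : X -> X) (g : X -> R) :
  ergodic mu T -> mu.-integrable setT (EFin \o g) ->
  (\int[mu]_x (g x)%:E < 0)%E ->
  {ae mu, forall x, exists C : R, forall n,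
    \sum_(1 <= k < n.+1) g (iter k T x) <= C}.
Proof.
move=> [pT _ ergT] ig g0.
pose M := max_birkhoff T g.
have iM n : mu.-integrable setT (EFin \o M n) by exact: integrable_max_birkhoff.
have mM n : measurable_fun setT (M n).
  by have /integrableP[/measurable_EFinP] := iM n.
pose A : set X := \bigcap_(c in setT) \bigcup_(n in setT) [set x | c%:R < M n x].
have mA : measurable A.
  apply: bigcap_measurable => // c _; apply: bigcup_measurable => n _.
  exact: measurable_superlevel.
have inv : T @^-1` A = A.
  (* As [M n.+1 x] is the maximum of 0 and [g x + M n (T x)], passing between [x] and [T x] only
     shifts the threshold by [g x]. *)
  apply/seteqP; split => x /= Ax c _.
    have [c' cc'] : exists c' : nat, c%:R - g x < c'%:R.
      by exists (Num.truncn (c%:R - g x)).+1; exact: truncnS_gt.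
    have [n _ /= Mn] := Ax c' I.
    exists n.+1 => //=; rewrite lt_max; apply/orP; right.
    by rewrite -ltrBlDl (lt_trans cc').
  have [c' cc'] : exists c' : nat, c%:R + g x < c'%:R.
    by exists (Num.truncn (c%:R + g x)).+1; exact: truncnS_gt.
  have [[_ /=|n _ /=]] := Ax c' I; first by rewrite ltNge ler0n.
  rewrite lt_max ltNge ler0n /= => Mn.
  exists n => //=; rewrite -(ltrD2l (g x)) addrC.
  exact: lt_trans Mn.
case: (ergT _ mA inv) => A1.
  have : {ae mu, forall x, ~ A x} by exists A; split => //= x /contrapT.
  apply: filterS => x nAx.
  (* Sums starting at [k = 1] are Birkhoff sums at [T x], so the bound is taken there. *)
  have /existsNP[c /not_implyP[_ nB]] : ~ A (T x).
    by rewrite -[A (T x)]/((T @^-1` A) x) inv.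
  exists c%:R => n; rewrite leNgt; apply/negP => cn; apply: nB; exists n => //=.
  apply: (lt_le_trans cn); rewrite big_add1 /=.
  under eq_bigr do rewrite -iterS iterSr.
  exact: birkhoff_sum_le_max.
exfalso; move: g0; apply/negP; rewrite -leNgt.
pose D n x := M n.+1 x - M n (T x).
have iMT n : mu.-integrable setT (EFin \o (M n \o T)).
  exact: integrable_measure_preserving (iM n).
have mD n : measurable_fun setT (EFin \o D n).
  apply/measurable_EFinP; apply: measurable_funB => //.
  by have /integrableP[/measurable_EFinP] := iMT n.
have DE n x : D n x = Num.max (- M n (T x)) (g x).
  by rewrite /D /= addr_maxl sub0r addrK.
have [mg _] := integrableP _ _ _ ig.
have Dcvg : {ae mu, forall x, setT x -> (D n x)%:E @[n --> \oo] --> (g x)%:E}.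
  apply: filterS (probability1_ae mA A1) => x; rewrite -inv => Ax _.
  (* Once [M n (T x)] exceeds [- g x], it does so for all larger [n], and [D n x] stays equal to
     [g x]. *)
  pose c := (Num.truncn (- g x)).+1.
  have cg : - g x < c%:R by exact: truncnS_gt.
  have [n _ /= Mn] := Ax c I.
  apply: cvg_near_cst; exists n => //= k nk.
  rewrite DE; congr EFin; apply/max_idPr; rewrite lerNl.
  by apply/ltW/(lt_trans cg)/(lt_le_trans Mn); exact: le_max_birkhoff.
have Ddom : {ae mu, forall x, forall n, setT x -> (`|(D n x)%:E| <= `|(g x)%:E|)%E}.
  apply: aeW => x n _; rewrite lee_fin DE.
  have := max_birkhoff_ge0 T g n (T x); rewrite -/M => M0.
  (* In the remaining case [g x < - M n (T x) <= 0], so the absolute value [M n (T x)] is below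
     [- g x]. *)
  case: (leP (- M n (T x)) (g x)) => // gM.
  by rewrite normrN (ger0_norm M0) ler_normr lerNr (ltW gM) orbT.
have [_ _ icvg] :=
  dominated_convergence measurableT mD mg Dcvg (integrable_abse ig) Ddom.
apply: (cvge_ge _ icvg); apply: nearW => n.
rewrite [leRHS](_ : _ = \int[mu]_x ((M n.+1 x)%:E - (M n (T x))%:E))%E; last by [].
rewrite (integralB_EFin measurableT (iM n.+1) (iMT n)).
have /= -> := integral_measure_preserving pT (iM n).
rewrite sube_ge0; last by apply/orP; left; exact: integrable_fin_num (iM n).
apply: (le_integral measurableT (iM n) (iM n.+1)) => x _; rewrite lee_fin.
exact: max_birkhoff_leS.
Qed.

(** * Mass above the mean *)

(** Otherwise [f <= m] almost everywhere, with [m] the mean; then [m - f] is nonnegative almost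
    everywhere with integral 0, hence vanishes almost everywhere, and [f] is constant. *)
Lemma exists_superlevel_gt0 (R : realType) (disp : measure_display)
    (X : measurableType disp) (mu : probability X R) (f : X -> R) :
  mu.-integrable setT (EFin \o f) ->
  (~ exists c : R, {ae mu, forall x, f x = c}) ->
  exists d : R, 0 < d /\
    (0 < mu [set x | (fine (\int[mu]_x (f x)%:E)%E + d < f x)%R])%E.
Proof.
move=> intf nconst; set m := fine _; apply: contrapT => nod; apply: nconst.
exists m.
have [/measurable_EFinP mf _] := integrableP _ _ _ intf.
have lefm : {ae mu, forall x, f x <= m}.
  (* The set where [f > m] is exhausted by countably many superlevel sets with positive margin. *)
  suff : mu.-negligible (\bigcup_k [set x | m + k.+1%:R^-1 < f x]).
    apply: negligibleS => x /negP; rewrite -ltNge => mfx.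
    pose k := Num.truncn (f x - m)^-1; exists k => //=.
    rewrite -ltrBrDl invf_plt ?posrE ?subr_gt0//; exact: truncnS_gt.
  apply: negligible_bigcup => k.
  apply/negligibleP; first exact: measurable_superlevel.
  apply/eqP; rewrite eq_le measure_ge0 andbT leNgt; apply/negP => pos.
  by apply: nod; exists k.+1%:R^-1; rewrite invr_gt0.
pose h x := m - f x.
have icst : mu.-integrable setT (EFin \o cst m).
  exact: finite_measure_integrable_cst.
have ih : mu.-integrable setT (EFin \o h) by exact: (integrableB measurableT icst intf).
have [mh _] := integrableP _ _ _ ih.
have h0 : (\int[mu]_x `|(EFin \o h) x| = 0)%E.
  transitivity (\int[mu]_x (EFin \o h) x)%E.
    apply: ae_eq_integral => //; first exact: measurableT_comp.
    apply: filterS lefm => x fm _ /=.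
    by rewrite ger0_norm// subr_ge0.
  have /= -> := integralB_EFin measurableT icst intf.
  have -> : (\int[mu]_x m%:E = m%:E)%E.
    by have /= -> := integral_cst mu measurableT m%:E; rewrite probability_setT mule1.
  by rewrite /m fineK ?subee ?(integrable_fin_num measurableT intf).
have := (ae_eq_integral_abs mu measurableT mh).1 h0.
by apply: filterS => x /(_ I) [/eqP]; rewrite subr_eq0 => /eqP.
Qed.

(** * Increments of the ergodic averages *)

Lemma ergodic_averageS (R : realType) (X : Type) (T : X -> X) (f : X -> R) N x :
  (0 < N)%N ->
  ergodic_average T f N.+1 x =
    ergodic_average T f N x
      + (f (iter N.+1 T x) - ergodic_average T f N x) / N.+1%:R.
Proof.
move=> N0; rewrite /ergodic_average [in LHS]big_nat_recr//=.
set s := \sum_(_ <= _ < _) _.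
have n0 : N%:R != 0 :> R by rewrite pnatr_eq0 -lt0n.
have n1 : 1 + N%:R != 0 :> R by rewrite addrC natr1 pnatr_eq0.
by rewrite -natr1; field; rewrite n0 addrC n1.
Qed.

(** The margin [4 * d] splits as follows: one [d] makes the integral of [g] negative, one absorbs
    [C / N], and two cover [(N + 1) * d / N <= 2 * d]. *)
Lemma ergodic_average_increment (R : realType) (disp : measure_display)
    (X : measurableType disp) (mu : probability X R) (T : X -> X) (f : X -> R)
    (d : R) :
  ergodic mu T -> mu.-integrable setT (EFin \o f) -> 0 < d ->
  (0 < mu [set x | (fine (\int[mu]_x (f x)%:E)%E + 4 * d < f x)%R])%E ->
  {ae mu, forall x, infinite_set [set N : nat | (1 <= N)%N /\
    ergodic_average T f N.+1 x > d / N%:R + ergodic_average T f N x]}.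
Proof.
move=> ergT intf d0; set m := fine _ => posE.
have [/measurable_EFinP mf _] := integrableP _ _ _ intf.
have icst : mu.-integrable setT (EFin \o cst (m + d)).
  exact: finite_measure_integrable_cst.
pose g x := f x - (m + d).
have ig : mu.-integrable setT (EFin \o g) by exact: (integrableB measurableT intf icst).
have g0 : (\int[mu]_x (g x)%:E < 0)%E.
  have /= -> := integralB_EFin measurableT intf icst.
  have /= -> := integral_cst mu measurableT (m + d)%:E.
  rewrite probability_setT mule1 -[X in (X - _)%E]fineK; last first.
    exact: integrable_fin_num.
  by rewrite -/m -EFinB lte_fin; lra.
have rec := ergodic_recurrence ergT (measurable_superlevel (m + 4 * d) mf) posE.
have bnd := birkhoff_sum_bounded_above ergT ig g0.
apply: filterS2 rec bnd => x rec [C bC].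
apply: frequently_infinite_set => k.
(* For [N >= K] the bound [C] is below [N * d], so the average of [f] exceeds [m + d] by at most
   [d]. *)
pose K := (Num.truncn (C / d)).+1.
have CK : C < K%:R * d by rewrite -ltr_pdivrMr// truncnS_gt.
(* The visit occurs at time [N.+1], the index of the term added in passing from [N] to [N.+1]; hence
   the successor in the lower bound. *)
have [[|N]] := rec (maxn k K).+1; first by case.
rewrite ltnS geq_max => -[/andP[kN KN] /= fN].
have N0 : (0 < N)%N by exact: leq_trans KN.
exists N; split => //; split => //.
have NR : 1 <= N%:R :> R by rewrite ler1n.
have aN : ergodic_average T f N x <= m + 2 * d.
  rewrite /ergodic_average mulrC ler_pdivrMr ?ltr0n//.
  have := bC N; rewrite /g sumrB sumr_const_nat subn1/= -mulr_natr => bCN.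
  have : K%:R * d <= N%:R * d by rewrite ler_pM2r// ler_nat.
  nra.
rewrite ergodic_averageS// [ltRHS]addrC ltrD2r.
rewrite ltr_pdivlMr ?ltr0n// -natr1 mulrDr mulr1 divfK; last first.
  by rewrite gt_eqF ?ltr0n.
have : d / N%:R <= d by rewrite ler_pdivrMr ?ltr0n// ler_peMr// ltW.
rewrite /= in fN *; lra.
Qed.

Theorem proposition3p2 (R : realType) (disp : measure_display)
    (X : measurableType disp) (mu : probability X R)
    (mu_std : standard_probability mu)
    (f : X -> R)
    (f_L1 : mu.-integrable setT (EFin \o f))
    (f_nonconst : ~ exists c : R, {ae mu, forall x, f x = c}) :
  exists d : R, 0 < d /\
    forall T : X -> X, ergodic mu T ->
      {ae mu, forall x,
        infinite_set [set N : nat | (1 <= N)%N /\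
          ergodic_average T f N.+1 x > d / N%:R + ergodic_average T f N x] /\
        infinite_set [set N : nat | (1 <= N)%N /\
          ergodic_average T f N.+1 x < - (d / N%:R) + ergodic_average T f N x]}.
Proof.
pose f' x := - f x.
have f'_L1 : mu.-integrable setT (EFin \o f') by exact: integrableN f_L1.
have f'_nonconst : ~ exists c : R, {ae mu, forall x, f' x = c}.
  move=> [c fc]; apply: f_nonconst; exists (- c).
  by apply: filterS fc => x <-; rewrite opprK.
have [e [e0 posE]] := exists_superlevel_gt0 f_L1 f_nonconst.
have [e' [e'0 posE']] := exists_superlevel_gt0 f'_L1 f'_nonconst.
(* One constant serves both [f] and [- f]; it is fixed before [T] is introduced. *)
pose d := Num.min e e' / 4.
have d0 : 0 < d by rewrite divr_gt0// lt_min e0.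
have de : 4 * d <= e by rewrite mulrC divfK// ge_min lexx.
have de' : 4 * d <= e' by rewrite mulrC divfK// ge_min lexx orbT.
(* Lowering the margin enlarges the superlevel set, so positivity survives. *)
have shrink (u : X -> R) (m a b : R) : mu.-integrable setT (EFin \o u) -> b <= a ->
    (0 < mu [set x | (m + a < u x)%R] -> 0 < mu [set x | (m + b < u x)%R])%E.
  move=> /integrableP[/measurable_EFinP mu_ _] ba /lt_le_trans; apply.
  apply: le_measure; rewrite ?inE; try exact: measurable_superlevel.
  by move=> x /=; apply: le_lt_trans; rewrite lerD2l.
exists d; split => // T ergT.
have up := ergodic_average_increment ergT f_L1 d0 (shrink _ _ _ _ f_L1 de posE).
have dn := ergodic_average_increment ergT f'_L1 d0 (shrink _ _ _ _ f'_L1 de' posE').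
apply: filterS2 up dn => x up dn; split => //.
have avgN N : ergodic_average T f' N x = - ergodic_average T f N x.
  by rewrite /ergodic_average sumrN mulrN.
apply: sub_infinite_set dn => N /= [N1]; rewrite !avgN => h.
by split => //; move: h; rewrite /=; lra.
Qed.
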